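(* For every integer $N\ge 2$, let $\mathcal{L}_N=\{0,1,\dots,N-1\}^2$, let $d_2(\mathbf i,\mathbf j)=\sqrt{|i_1-j_1|^2+|i_2-j_2|^2}$ be the Euclidean distance on $\mathcal{L}_N$, and let $G_{N-1}=(\mathcal{L}_N,E_{N-1})$ be the directed graph on $\mathcal{L}_N$ induced by $V_{N-1}$ (see context). Then $c_{G_{N-1}}=d_2$ for the cost $c=d_2$, hence $\Gamma_{G_{N-1},d_2}=0$ and $$\mathcal{W}_{d_2}(\mu,\nu)=F_{G_{N-1},d_2}(\mu-\nu)$$ for every pair of probability measures $\mu,\nu$ on $\mathcal{L}_N$. Moreover, $$\lim_{N\to+\infty}\frac{\#E_{N-1}}{N^4}=\frac{6}{\pi^2}.$$
   Context: Let $V_0=\{(1,0),(0,1),(-1,0),(0,-1)\}$ and, for an integer $L\ge1$, $$V_L=V_0\cup\{(i_1,i_2)\in(\mathbb{Z}\setminus\{0\})^2:\ |i_1|\le L,\ |i_2|\le L,\ |i_1|\text{ and }|i_2|\text{ coprime}\}.$$ For $1\le L\le N-1$, the graph induced by $V_L$ is $G_L=(\mathcal{L}_N,E_L)$ with $E_L=\{(\mathbf i,\mathbf i+\mathbf j):\ \mathbf i\in\mathcal{L}_N,\ \mathbf j\in V_L,\ \mathbf i+\mathbf j\in\mathcal{L}_N\}$ (directed edges). For a finite set $X$, a cost $c:X\times X\to[0,\infty)$ and probability vectors $\mu,\nu$ on $X$, $\mathcal{W}_c(\mu,\nu)=\inf_{\pi\in\Pi(\mu,\nu)}\sum_{(x,y)\in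 X\times X}c(x,y)\pi(x,y)$, where $\Pi(\mu,\nu)$ is the set of probability measures $\pi$ on $X\times X$ with $\sum_y\pi(x,y)=\mu(x)$ and $\sum_x\pi(x,y)=\nu(y)$ for all $x,y$. For a directed graph $G=(V,E)$ without self-loops, a cost $c$ on edges with values in $[0,\infty)$, and $b:V\to\mathbb{R}$ with $\sum_{v\in V}b(v)=0$, a $b$-flow is a function $f:E\to[0,\infty)$ with $\sum_{v:(u,v)\in E}f(u,v)-\sum_{v:(v,u)\in E}f(v,u)=b(u)$ for all $u\in V$; $\mathcal{F}(G,b)$ is the set of $b$-flows, and $F_{G,c}(b)=\min_{f\in\mathcal{F}(G,b)}\sum_{(u,v)\in E}c(u,v)f(u,v)$. For a directed graph $G$ with vertex set $X$ and a distance $c$ on $X$, $c_G(x,y)$ denotes the minimum, over all directed paths in $G$ from $x$ to $y$, of the sum of the costs $c$ of the edges of the path (with $c_G(x,x)=0$, via the trivial path), and $\Gamma_{G,c}=\max\{1-c(x,y)/c_G(x,y):\ x,y\in X,\ x\neq y\}$. *)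

(* Defs.v *)
From HB Require Import structures.
From mathcomp Require Import all_boot all_order all_algebra.
From mathcomp Require Import mathcomp_extra boolp classical_sets functions reals.
From mathcomp Require Import topology normedtype sequences trigo.

Set Implicit Arguments.
Unset Strict Implicit.
Unset Printing Implicit Defensive.
Import Order.TTheory GRing.Theory Num.Theory numFieldNormedType.Exports.

Local Open Scope classical_set_scope.
Local Open Scope ring_scope.

(* Attained bounds; the value is -1 by default when there is none, so that an
   equation between a minimum or maximum and a nonnegative real also says that
   it is attained. *)
Definition minimum (R : realType) (S : set R) : R := xget (-1) (S `&` lbound S).
Definition maximum (R : realType) (S : set R) : R := xget (-1) (S `&` ubound S).

Definition prob_vector (R : realType) (X : finType) (mu : X -> R) : Prop :=
  (forall x, 0 <= mu x) /\ \sum_x mu x = 1.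

Section Wasserstein.
Context {R : realType} {X : finType}.
Implicit Types (c : X -> X -> R) (mu nu : X -> R).

Definition couplings mu nu : set (X * X -> R) :=
  [set p | [/\ prob_vector p,
               forall x, \sum_y p (x, y) = mu x &
               forall y, \sum_x p (x, y) = nu y]].

Definition wasserstein c mu nu : R :=
  inf [set \sum_(e : X * X) c e.1 e.2 * p e | p in couplings mu nu].

End Wasserstein.

(* A directed graph on the vertex set X is given by its set of edges. *)
Section Digraph.
Context {R : realType} {X : finType}.
Implicit Types (E : {set X * X}) (c : X -> X -> R).

(* Functions on E are represented by functions on X * X, whose values outside E
   are never used. *)
Definition flows E (b : X -> R) : set (X * X -> R) :=
  [set f | (forall e, e \in E -> 0 <= f e) /\
           forall u, \sum_(v | (u, v) \in E) f (u, v)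
                     - \sum_(v | (v, u) \in E) f (v, u) = b u].

Definition flow_cost E c (b : X -> R) : R :=
  minimum [set \sum_(e in E) c e.1 e.2 * f e | f in flows E b].

(* x :: p is a directed path from x to y; p = [::] is the trivial path. *)
Definition dipaths E (x y : X) : set (seq X) :=
  [set p | path [rel u v | (u, v) \in E] x p /\ last x p = y].

Definition path_cost c (x : X) (p : seq X) : R :=
  \sum_(e <- zip (x :: p) p) c e.1 e.2.

Definition graph_dist E c (x y : X) : R :=
  minimum [set path_cost c x p | p in dipaths E x y].

Definition Gamma E c : R :=
  maximum [set 1 - c e.1 e.2 / graph_dist E c e.1 e.2
          | e in [set e : X * X | e.1 != e.2]].

End Digraph.

Notation lattice N := ('I_N * 'I_N)%type.

Definition d2 (R : realType) (N : nat) (i j : lattice N) : R :=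
  Num.sqrt (`|(i.1)%:R - (j.1)%:R| ^+ 2 + `|(i.2)%:R - (j.2)%:R| ^+ 2).

Definition V0 : seq (int * int) := [:: (1, 0); (0, 1); (-1, 0); (0, -1)].

Definition V (L : nat) : {pred int * int} :=
  [pred j | (j \in V0) ||
    [&& j.1 != 0, j.2 != 0, (`|j.1| <= L)%N, (`|j.2| <= L)%N
      & coprime `|j.1|%N `|j.2|%N]].

(* The pairs (i, i + j) with j in V_L, written as (i, k) with k - i in V_L. *)
Definition edges (N L : nat) : {set lattice N * lattice N} :=
  [set e : lattice N * lattice N |
    ((e.2.1)%:Z - (e.1.1)%:Z, (e.2.2)%:Z - (e.1.2)%:Z) \in V L].

(* Main.v *)
Require Import Defs.
From HB Require Import structures.
From mathcomp Require Import all_boot all_order all_algebra.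
From mathcomp Require Import ring lra zify.
From mathcomp Require Import mathcomp_extra boolp classical_sets functions reals.
From mathcomp Require Import topology normedtype sequences derive trigo.
Import Order.TTheory GRing.Theory Num.Theory numFieldNormedType.Exports.
Set Implicit Arguments.
Unset Strict Implicit.
Unset Printing Implicit Defensive.

Local Open Scope classical_set_scope.
Local Open Scope ring_scope.

(** In this graph a straight line costs nothing extra.  If a lattice vector has
    coordinates with gcd [g], it is [g] times a primitive vector, which is a
    step of the graph; the [g] equal steps run along the segment and have total
    Euclidean length the distance of the ends ([geodesic]).  By the triangle
    inequality no path is shorter, hence the graph distance is the Euclidean
    one and the relative defect is zero.

    Transport and flow then have the same value.  A coupling becomes a flow of
    the same cost when its masses travel along geodesics ([coupling_to_flow]).
    Conversely a flow is a mass plan in which some vertices are crossed by more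
    mass than they send or receive; mass crossing a vertex can be redirected to
    bypass it, and the triangle inequality says that this does not increase the
    cost.  Treating the vertices one after the other leaves a coupling
    ([balance_vertex], [flow_to_plan]).  The optimal coupling exists by
    compactness, so the minimum over flows is attained too.

    For the number of edges, summing over displacements gives
    [4 A(N, 1) + O(N^2)], where [A(N, d)] is the sum of [(N - d a) (N - d b)] over
    coprime positive [a, b] with [d a, d b <= N].  Sorting all pairs by their gcd
    [k] gives [\sum_k A(N, d k) = (\sum_a (N - d a))^2], about [N^4 / (4 d^2)]
    ([line_sum_sqr]).  With [h(N, d) = 4 d^2 A(N, d) / N^4] this reads
    [\sum_k h(N, d k) / k^2 = 1 + o(1)] as [N / d] grows.  The constant solution is
    [1 / zeta(2)], and since the terms [k >= 2] have total weight
    [zeta(2) - 1 <= 3/4 < 1], the deviation from it contracts at each use of the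
    identity, whence [h(N, 1)] tends to [1 / zeta(2)] ([contraction_step]).
    Finally [zeta(2) = pi^2 / 6] follows from [sin x <= x <= tan x] and an exact
    value for the sum of [1 / sin^2] over the odd multiples of [pi / 2^(n+2)]
    below [pi / 2] ([sum_inv_sin2]). *)

(** * Straight paths and the graph distance *)

Lemma minimum_eq (R : realType) (S : set R) (m : R) :
  S m -> lbound S m -> minimum S = m.
Proof.
move=> Sm lm; rewrite /minimum; case: xgetP => [y _ [Sy ly]|/(_ m)].
  by apply/le_anti; rewrite ly//= lm.
by case; split.
Qed.

Lemma maximum_eq (R : realType) (S : set R) (m : R) :
  S m -> ubound S m -> maximum S = m.
Proof.
move=> Sm lm; rewrite /maximum; case: xgetP => [y _ [Sy ly]|/(_ m)].
  by apply/le_anti; rewrite ly//= lm.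
by case; split.
Qed.

Section PathCost.
Context {R : realType} {X : finType} (c : X -> X -> R).

Lemma path_cost_nil x : path_cost c x [::] = 0.
Proof. by rewrite /path_cost big_nil. Qed.

Lemma path_cost_cons x z p : path_cost c x (z :: p) = c x z + path_cost c z p.
Proof. by rewrite /path_cost /= big_cons. Qed.

Lemma path_cost_ge x p : (forall x, c x x = 0) ->
  (forall x y z, c x z <= c x y + c y z) -> c x (last x p) <= path_cost c x p.
Proof.
move=> c0 ctri; elim: p x => [|z p IH] x /=; first by rewrite path_cost_nil c0.
by rewrite path_cost_cons (le_trans (ctri x z _))// lerD2l.
Qed.

(** Under the triangle inequality no path beats the direct step, whether or not
    that step is an edge; so one path of cost [c x y] settles the minimum. *)
Lemma graph_dist_eq (E : {set X * X}) x y p : (forall x, c x x = 0) ->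
  (forall x y z, c x z <= c x y + c y z) ->
  dipaths E x y p -> path_cost c x p = c x y -> graph_dist E c x y = c x y.
Proof.
move=> c0 ctri pxy cp; apply: minimum_eq; first by exists p.
by move=> _ [q [_ <-] <-]; apply: path_cost_ge.
Qed.

End PathCost.

Section Euclid.
Context {R : realType}.

Lemma minkowski2 (a b c d : R) :
  Num.sqrt ((a + c) ^+ 2 + (b + d) ^+ 2)
  <= Num.sqrt (a ^+ 2 + b ^+ 2) + Num.sqrt (c ^+ 2 + d ^+ 2).
Proof.
set s := Num.sqrt (a ^+ 2 + b ^+ 2); set t := Num.sqrt (c ^+ 2 + d ^+ 2).
have s2 : s ^+ 2 = a ^+ 2 + b ^+ 2 by rewrite sqr_sqrtr// addr_ge0// sqr_ge0.
have t2 : t ^+ 2 = c ^+ 2 + d ^+ 2 by rewrite sqr_sqrtr// addr_ge0// sqr_ge0.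
have s0 : 0 <= s by apply: sqrtr_ge0.
have t0 : 0 <= t by apply: sqrtr_ge0.
(* Lagrange's identity: s^2 t^2 - (ac + bd)^2 = (ad - bc)^2 *)
have cs : a * c + b * d <= s * t.
  rewrite (le_trans (ler_norm _))// -(@ler_pXn2r _ 2)// ?nnegrE ?mulr_ge0//.
  rewrite real_normK ?num_real// exprMn s2 t2 -subr_ge0.
  rewrite [leRHS](_ : _ = (a * d - b * c) ^+ 2) ?sqr_ge0//; ring.
rewrite -(@ler_pXn2r _ 2)// ?nnegrE ?addr_ge0 ?sqrtr_ge0//.
rewrite sqr_sqrtr ?addr_ge0 ?sqr_ge0// [(s + t) ^+ 2]sqrrD s2 t2.
rewrite -subr_ge0 [leRHS](_ : _ = (s * t - (a * c + b * d)) *+ 2).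
  by rewrite mulrn_wge0// subr_ge0.
ring.
Qed.

Variable N : nat.
Implicit Types x y z : lattice N.

Lemma d2E x y : d2 R x y =
  Num.sqrt (((x.1)%:R - (y.1)%:R) ^+ 2 + ((x.2)%:R - (y.2)%:R) ^+ 2).
Proof. by rewrite /d2 !real_normK ?num_real. Qed.

Lemma d2xx x : d2 R x x = 0.
Proof. by rewrite d2E !subrr !expr0n/= addr0 sqrtr0. Qed.

Lemma d2_gt0 x y : x != y -> 0 < d2 R x y.
Proof.
rewrite d2E sqrtr_gt0 lt0r; case: x y => [x1 x2] [y1 y2] /= xy.
rewrite addr_ge0 ?sqr_ge0// andbT paddr_eq0 ?sqr_ge0// !sqrf_eq0 !subr_eq0.
by rewrite !eqr_nat; apply: contra xy.
Qed.

Lemma d2_triangle x y z : d2 R x z <= d2 R x y + d2 R y z.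
Proof.
rewrite !d2E (le_trans _ (minkowski2 _ _ _ _))//.
by rewrite !(addrA (_ - _) _) !subrK.
Qed.

Lemma d2_disp x y (g : nat) (u v : int) :
  (y.1)%:Z - (x.1)%:Z = g%:Z * u -> (y.2)%:Z - (x.2)%:Z = g%:Z * v ->
  d2 R x y = g%:R * Num.sqrt (u%:~R ^+ 2 + v%:~R ^+ 2).
Proof.
move=> /(congr1 (fun n : int => n%:~R : R)) + /(congr1 (fun n : int => n%:~R : R)).
rewrite !intrM !intrB -!pmulrn => hu hv.
rewrite d2E -(sqrrN (_ - _)) -[in X in _ + X](sqrrN (_ - _)) !opprB hu hv.
rewrite !exprMn -mulrDr sqrtrM ?sqr_ge0// sqrtr_sqr ger0_norm//.
Qed.

End Euclid.

(** As [gcd(0, b) = b], the four axis steps are the coprime pairs having a zero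
    coordinate: a single coprimality test covers both parts of [V L]. *)
Lemma mem_V L (j : int * int) : (0 < L)%N ->
  (j \in V L) = [&& (`|j.1| <= L)%N, (`|j.2| <= L)%N & coprime `|j.1| `|j.2|].
Proof.
case: j => [a b] L0; rewrite inE /= /V0 !inE !xpair_eqE.
have [->|a0] := eqVneq a 0.
  rewrite /= /coprime gcd0n; lia.
have [->|b0] := eqVneq b 0.
  rewrite /= /coprime gcdn0; lia.
rewrite /=; apply: orb_idl; lia.
Qed.

(** Displacements inside the square have coordinates at most [N - 1], which makes
    the box condition of [V N.-1] automatic. *)
Lemma mem_edges N (x y : lattice N) : (1 < N)%N ->
  ((x, y) \in edges N N.-1) =
  coprime `|(y.1)%:Z - (x.1)%:Z| `|(y.2)%:Z - (x.2)%:Z|.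
Proof.
case: x y => [x1 x2] [y1 y2] N1.
rewrite finset.in_set mem_V /=; last lia.
have short (a b : 'I_N) : (`|a%:Z - b%:Z| <= N.-1)%N.
  by have := ltn_ord a; have := ltn_ord b; lia.
by rewrite !short.
Qed.

Section Straight.
Context {R : realType} (N : nat).
Hypothesis N1 : (1 < N)%N.

(** [g] equal primitive steps subdivide the segment from [x] to [y], so their
    lengths add up to its length. *)
Lemma straight_path (g : nat) (u v : int) (x y : lattice N) :
  coprime `|u| `|v| ->
  (y.1)%:Z - (x.1)%:Z = g%:Z * u -> (y.2)%:Z - (x.2)%:Z = g%:Z * v ->
  exists2 p, dipaths (edges N N.-1) x y p & path_cost (@d2 R N) x p = d2 R x y.
Proof.
move=> cuv; elim: g x => [|g IH] x hu hv.
  exists [::]; last first.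
    by rewrite path_cost_nil (d2_disp hu hv) mul0r.
  split => //=; case: x y hu hv => [x1 x2] [y1 y2] /= hu hv.
  by congr (_, _); apply/val_inj => /=; lia.
(* the next point lies between the endpoints, hence stays in the square *)
have in_range (a b : 'I_N) (w : int) : b%:Z - a%:Z = g.+1%:Z * w ->
    {d : 'I_N | d%:Z = a%:Z + w}.
  move=> h; have dN : (`|(a%:Z + w)%R| < N)%N.
    by have := ltn_ord a; have := ltn_ord b; nia.
  by exists (Ordinal dN) => /=; have := ltn_ord a; have := ltn_ord b; nia.
have [z1 hz1] := in_range _ _ _ hu; have [z2 hz2] := in_range _ _ _ hv.
pose z : lattice N := (z1, z2).
have hu' : (y.1)%:Z - (z.1)%:Z = g%:Z * u by rewrite /= hz1; lia.
have hv' : (y.2)%:Z - (z.2)%:Z = g%:Z * v by rewrite /= hz2; lia.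
have hu1 : (z.1)%:Z - (x.1)%:Z = 1%N%:Z * u by rewrite /= hz1; lia.
have hv1 : (z.2)%:Z - (x.2)%:Z = 1%N%:Z * v by rewrite /= hz2; lia.
have [p [pp lp] cp] := IH z hu' hv'.
exists (z :: p); first by split => //=; rewrite pp mem_edges// hu1 hv1 !mul1r cuv.
rewrite path_cost_cons cp (d2_disp hu hv) (d2_disp hu' hv').
by rewrite (d2_disp hu1 hv1) -mulrDl -natrD.
Qed.

(** Dividing a displacement by the gcd of its coordinates leaves a primitive
    step. *)
Lemma geodesic (x y : lattice N) :
  exists2 p, dipaths (edges N N.-1) x y p & path_cost (@d2 R N) x p = d2 R x y.
Proof.
pose a := (y.1)%:Z - (x.1)%:Z; pose b := (y.2)%:Z - (x.2)%:Z.
have [g0|g0] := posnP (gcdn `|a| `|b|).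
  have [a0 b0] : a = 0 /\ b = 0.
    by move/eqP: g0; rewrite -leqn0 leqNgt gcdn_gt0 negb_or; lia.
  by apply: (@straight_path 0 1 0); rewrite // -?/a -?/b ?a0 ?b0 mul0r.
pose g := gcdn `|a| `|b|.
have scale (c : int) : (g %| `|c|)%N -> c = g%:Z * (sgz c * (`|c| %/ g)%N%:Z).
  by move=> gc; rewrite mulrCA -PoszM mulnC divnK// -intEsg.
apply: (straight_path _ (scale a (dvdn_gcdl _ _)) (scale b (dvdn_gcdr _ _))).
have abs_step (c : int) : `|(sgz c * (`|c| %/ g)%N%:Z)%R|%N = (`|c| %/ g)%N.
  by rewrite abszM absz_sg; have [->|] := eqVneq c 0; rewrite ?mul1n// absz0 div0n.
by rewrite !abs_step /coprime -(eqn_pmul2r g0) muln_gcdl !divnK ?dvdn_gcdl ?dvdn_gcdr//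
  mul1n.
Qed.

Lemma graph_dist_d2 (x y : lattice N) :
  graph_dist (edges N N.-1) (@d2 R N) x y = d2 R x y.
Proof.
have [p pxy cp] := geodesic x y.
by apply: graph_dist_eq pxy cp; [exact: d2xx|exact: d2_triangle].
Qed.

Lemma Gamma_d2 : Gamma (edges N N.-1) (@d2 R N) = 0.
Proof.
have ratio (e : lattice N * lattice N) : e.1 != e.2 ->
    1 - d2 R e.1 e.2 / graph_dist (edges N N.-1) (@d2 R N) e.1 e.2 = 0.
  by move=> e12; rewrite graph_dist_d2 divff ?subrr// gt_eqF ?d2_gt0.
apply: maximum_eq; last by move=> _ [e e12 <-]; rewrite ratio.
have N0 : (0 < N)%N by exact: ltnW.
pose e : lattice N * lattice N :=
  ((Ordinal N0, Ordinal N0), (Ordinal N1, Ordinal N0)).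
by exists e; rewrite ?ratio.
Qed.

End Straight.

(** * From flows to transport plans *)

Section Shortcut.
Context {R : realFieldType} {X : finType} (d : X -> X -> R).
Hypothesis d0 : forall x, d x x = 0.
Hypothesis dtri : forall x y z, d x z <= d x y + d y z.
Implicit Types g : X -> X -> R.

Definition outflow g u := \sum_w g u w.
Definition inflow g w := \sum_u g u w.
Definition plan_cost g := \sum_u \sum_w d u w * g u w.

Lemma sum_pick (F : X -> R) x : \sum_u (u == x)%:R * F u = F x.
Proof.
rewrite (bigD1 x)//= eqxx mul1r big1 ?addr0// => i /negPf ->; exact: mul0r.
Qed.

(** Redirect an amount [s] of the mass crossing [x]: the entries into [x] and the
    exits from [x] are reduced proportionally, and the mass that arrived from [u]
    and left to [w] goes from [u] to [w] directly. *)
Definition shortcut g x s u w : R :=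
  let r := outflow g x in let c := inflow g x in
  g u w - (s / c) * ((w == x)%:R * g u x) - (s / r) * ((u == x)%:R * g x w)
  + s / (c * r) * (g u x * g x w).

Lemma shortcut_ge0 g x s u w : (forall u w, 0 <= g u w) -> g x x = 0 ->
  0 < s -> s <= outflow g x -> s <= inflow g x -> 0 <= shortcut g x s u w.
Proof.
move=> g0 gx s0 sr sc; have r0 := lt_le_trans s0 sr; have c0 := lt_le_trans s0 sc.
have prod0 : 0 <= s / (inflow g x * outflow g x) * (g u x * g x w).
  by rewrite mulr_ge0 ?divr_ge0 ?mulr_ge0// ltW.
rewrite /shortcut addr_ge0//; move=> {prod0}.
have part t (a : R) : 0 <= a -> 0 < t -> s <= t -> 0 <= a - s / t * a.
  move=> a0 t0 st; rewrite -{1}[a]mul1r -mulrBl mulr_ge0// subr_ge0.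
  by rewrite ler_pdivrMr// mul1r.
have [->|ux] := eqVneq u x; have [->|wx] := eqVneq w x; rewrite ?mul1r ?mul0r.
- by rewrite gx !mulr0 !subr0 lexx.
- by rewrite mulr0 subr0 part.
- by rewrite mulr0 subr0 part.
- by rewrite !mulr0 !subr0 g0.
Qed.

Lemma outflow_shortcut g x s u : outflow g x != 0 -> inflow g x != 0 ->
  outflow (shortcut g x s) u = outflow g u - s * (u == x)%:R.
Proof.
move=> r0 c0; rewrite {1}/outflow /shortcut big_split/= !sumrB -!mulr_sumr.
rewrite sum_pick -/(outflow _ _) -/(outflow _ _).
by field; rewrite r0 c0.
Qed.

Lemma inflow_shortcut g x s w : outflow g x != 0 -> inflow g x != 0 ->
  inflow (shortcut g x s) w = inflow g w - s * (w == x)%:R.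
Proof.
move=> r0 c0; rewrite {1}/inflow /shortcut big_split/= !sumrB -!mulr_sumr.
rewrite sum_pick -!mulr_suml -/(inflow _ _) -/(inflow _ _).
by field; rewrite r0 c0.
Qed.

(** Averaging [d u w <= d u x + d x w] over the redirected mass: its direct trips
    cost at most what was saved on the entries and the exits. *)
Lemma plan_cost_shortcut g x s : (forall u w, 0 <= g u w) ->
  0 < outflow g x -> 0 < inflow g x -> 0 <= s ->
  plan_cost (shortcut g x s) <= plan_cost g.
Proof.
move=> g0 r0 c0 s0; set r := outflow g x in r0; set c := inflow g x in c0.
pose A := \sum_u d u x * g u x; pose B := \sum_w d x w * g x w.
pose C := \sum_u \sum_w d u w * (g u x * g x w).
have -> : plan_cost (shortcut g x s) =
    plan_cost g - s / c * A - s / r * B + s / (c * r) * C.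
  rewrite /plan_cost /shortcut -/r -/c.
  under eq_bigr => u _.
    under eq_bigr => w _.
      rewrite (_ : d u w * _ = d u w * g u w
        - s / c * ((w == x)%:R * (d u w * g u x))
        - (u == x)%:R * (s / r * (d u w * g x w))
        + s / (c * r) * (d u w * (g u x * g x w))); last by ring.
      over.
    rewrite big_split/= !sumrB -!mulr_sumr sum_pick; over.
  by rewrite big_split/= !sumrB -!mulr_sumr sum_pick.
have : C <= r * A + c * B.
  have -> : r * A + c * B = \sum_u \sum_w (d u x + d x w) * (g u x * g x w).
    under [RHS]eq_bigr => u _.
      under eq_bigr => w _ do rewrite mulrDl mulrA mulrCA.
      rewrite big_split/= -!mulr_sumr; over.
    by rewrite big_split/= -!mulr_suml mulrC.
  by do 2!apply: ler_sum => ? _; rewrite ler_wpM2r ?mulr_ge0.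
move=> /(ler_wpM2l (divr_ge0 s0 (ltW (mulr_gt0 c0 r0)))).
have -> : s / (c * r) * (r * A + c * B) = s / c * A + s / r * B.
  by field; rewrite !gt_eqF.
lra.
Qed.

(** Loops are free of charge and change the outflow and the inflow of [x] alike,
    so the amount of mass staying at [x] can be chosen at will. *)
Definition set_loop g x (t : R) u w : R :=
  if (u == x) && (w == x) then t else g u w.

Lemma plan_cost_set_loop g x t : plan_cost (set_loop g x t) = plan_cost g.
Proof.
apply: eq_bigr => u _; apply: eq_bigr => w _; rewrite /set_loop.
by case: andP => [[/eqP-> /eqP->]|//]; rewrite d0 !mul0r.
Qed.

Lemma outflow_set_loop g x t u :
  outflow (set_loop g x t) u = outflow g u + (t - g x x) * (u == x)%:R.
Proof.
rewrite /outflow /set_loop; have [->|ux] := eqVneq u x; last first.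
  by rewrite mulr0 addr0.
rewrite (bigD1 x)//= eqxx [in RHS](bigD1 x)//= mulr1.
under eq_bigr => w /negPf-> do [].
ring.
Qed.

Lemma inflow_set_loop g x t w :
  inflow (set_loop g x t) w = inflow g w + (t - g x x) * (w == x)%:R.
Proof.
rewrite /inflow /set_loop; have [->|wx] := eqVneq w x; last first.
  by rewrite mulr0 addr0; under eq_bigr do rewrite andbF.
rewrite (bigD1 x)//= eqxx [in RHS](bigD1 x)//= mulr1.
under eq_bigr => u /negPf-> do [].
ring.
Qed.

(** Without a loop at [x], the outflow exceeds [m] and the inflow exceeds [n] by
    the same amount [s], because [m - n] is the balance of [g] at [x].  A positive
    excess is redirected past [x]; a deficit is filled by a loop at [x].  Neither
    operation disturbs the other vertices. *)
Lemma balance_vertex g x (m n : R) : 0 <= m -> 0 <= n ->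
  (forall u w, 0 <= g u w) -> outflow g x - inflow g x = m - n ->
  exists g', [/\ forall u w, 0 <= g' u w, plan_cost g' <= plan_cost g,
    outflow g' x = m, inflow g' x = n &
    forall u, u != x -> outflow g' u = outflow g u /\ inflow g' u = inflow g u].
Proof.
move=> m0 n0 g0 bal.
(* a loop at [x] would be reduced twice by [shortcut] and might become negative *)
pose g1 := set_loop g x 0.
have g1_ge0 u w : 0 <= g1 u w by rewrite /g1 /set_loop; case: ifP.
have g1x : g1 x x = 0 by rewrite /g1 /set_loop eqxx.
have g1out u : u != x -> outflow g1 u = outflow g u.
  by move=> /negPf ux; rewrite outflow_set_loop ux mulr0 addr0.
have g1in u : u != x -> inflow g1 u = inflow g u.
  by move=> /negPf ux; rewrite inflow_set_loop ux mulr0 addr0.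
have {}bal : outflow g1 x - m = inflow g1 x - n.
  rewrite outflow_set_loop inflow_set_loop eqxx !mulr1; lra.
set s := outflow g1 x - m.
have [s0|s0] := ltrP 0 s.
  have r0 : 0 < outflow g1 x by move: s0; rewrite /s; lra.
  have c0 : 0 < inflow g1 x by move: s0; rewrite /s bal; lra.
  exists (shortcut g1 x s); split.
  - move=> u w; apply: shortcut_ge0 => //; rewrite /s; first lra.
    by rewrite bal; lra.
  - rewrite -(plan_cost_set_loop g x 0); apply: plan_cost_shortcut => //.
    exact: ltW.
  - by rewrite outflow_shortcut ?gt_eqF// eqxx mulr1 /s; ring.
  - by rewrite inflow_shortcut ?gt_eqF// eqxx mulr1 /s bal; ring.
  - move=> u ux; rewrite outflow_shortcut ?inflow_shortcut ?gt_eqF//.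
    by rewrite (negPf ux) mulr0 !subr0 g1out ?g1in.
exists (set_loop g1 x (- s)); split.
- by move=> u w; rewrite /set_loop; case: ifP => // _; rewrite oppr_ge0.
- by rewrite !plan_cost_set_loop.
- by rewrite outflow_set_loop g1x eqxx mulr1 /s; ring.
- by rewrite inflow_set_loop g1x eqxx mulr1 /s bal; ring.
- move=> u ux; rewrite outflow_set_loop inflow_set_loop (negPf ux) !mulr0 !addr0.
  by rewrite g1out ?g1in.
Qed.

(** Balancing a vertex preserves the flows through the vertices balanced before
    it, so one pass over all vertices suffices. *)
Lemma flow_to_plan g (mu nu : X -> R) :
  (forall x, 0 <= mu x) -> (forall x, 0 <= nu x) -> (forall u w, 0 <= g u w) ->
  (forall x, outflow g x - inflow g x = mu x - nu x) ->
  exists g', [/\ forall u w, 0 <= g' u w, plan_cost g' <= plan_cost g,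
    forall x, outflow g' x = mu x & forall x, inflow g' x = nu x].
Proof.
move=> mu0 nu0 g0 bal.
suff [g' [g'0 cg' _ bg']] : exists g', [/\ forall u w, 0 <= g' u w,
    plan_cost g' <= plan_cost g,
    forall x, outflow g' x - inflow g' x = mu x - nu x &
    forall x, x \in enum X -> outflow g' x = mu x /\ inflow g' x = nu x].
  exists g'; split=> // x; have [] := bg' x _; rewrite ?mem_enum//.
elim: (enum X) => [|x xs [g1 [g10 cg1 bal1 bg1]]]; first by exists g.
have [g2 [g20 cg2 rx cx other]] := balance_vertex (mu0 x) (nu0 x) g10 (bal1 x).
exists g2; split=> //; first exact: le_trans cg1.
- move=> u; have [->|ux] := eqVneq u x; first by rewrite rx cx.
  by have [-> ->] := other u ux.
- move=> u; rewrite inE; have [->//|ux /= uxs] := eqVneq u x.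
  by have [-> ->] := other u ux; exact: bg1.
Qed.

End Shortcut.

(** * Minimal transport cost and minimal flow cost *)

Section PathFlow.
Context {R : realType} {X : finType} (c : X -> X -> R) (E : {set X * X}).

Lemma sum_pair_cost (g : X -> X -> R) :
  \sum_(e : X * X) c e.1 e.2 * g e.1 e.2 = plan_cost c g.
Proof. by rewrite [RHS]pair_bigA. Qed.

(** One unit of mass moving along the path is a flow between its ends: each
    internal vertex gains and loses it as often. *)
Lemma path_flow x p : path [rel u v | (u, v) \in E] x p ->
  exists g : X -> X -> R, [/\ forall u w, 0 <= g u w,
    forall u w, (u, w) \notin E -> g u w = 0,
    forall u, outflow g u - inflow g u = (u == x)%:R - (u == last x p)%:R &
    plan_cost c g = path_cost c x p].
Proof.
elim: p x => [|z p IH] x /= => [_|/andP[xz /IH[g [g0 gE bal cg]]]].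
  exists (fun _ _ => 0); split=> //.
  - by move=> u; rewrite /outflow /inflow !big1// !subrr.
  - by rewrite path_cost_nil /plan_cost big1// => u _; rewrite big1// => w; rewrite mulr0.
pose delta u w : R := (u == x)%:R * (w == z)%:R.
exists (fun u w => g u w + delta u w); split.
- by move=> u w; rewrite addr_ge0// mulr_ge0.
- move=> u w uwE; rewrite gE// add0r /delta.
  have [ux|] := eqVneq u x; last by rewrite mul0r.
  have [wz|] := eqVneq w z; last by rewrite mulr0.
  by move: uwE; rewrite ux wz xz.
- move=> u; rewrite /outflow /inflow !big_split/= /delta -mulr_sumr -mulr_suml.
  have sum1 (t : X) : \sum_w (w == t)%:R = 1 :> R.
    by rewrite -[RHS](sum_pick (fun=> 1) t); apply: eq_bigr => w _; rewrite mulr1.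
  rewrite !sum1 mulr1 mul1r opprD addrACA -/(outflow g u) -/(inflow g u) bal.
  ring.
rewrite path_cost_cons -cg /plan_cost -[c x z](sum_pick (fun u => c u z) x) -big_split/=.
apply: eq_bigr => u _; rewrite -(sum_pick (fun w => c u w) z) mulr_sumr -big_split/=.
apply: eq_bigr => w _; rewrite /delta; ring.
Qed.

End PathFlow.

Section OptimalCoupling.
Context {R : realType} {X : finType} (c : X -> X -> R).
Variables mu nu : X -> R.
Hypotheses (mu_prob : prob_vector mu) (nu_prob : prob_vector nu).

Lemma product_coupling : couplings mu nu (fun e => mu e.1 * nu e.2).
Proof.
have [mu0 mu1] := mu_prob; have [nu0 nu1] := nu_prob.
have row x : \sum_y mu x * nu y = mu x by rewrite -mulr_sumr nu1 mulr1.
have col y : \sum_x mu x * nu y = nu y by rewrite -mulr_suml mu1 mul1r.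
split=> //=; split=> [e|]; first by rewrite mulr_ge0.
by rewrite -(pair_bigA _ (fun x y => mu x * nu y))/= (eq_bigr _ (fun x _ => row x)).
Qed.

Lemma closed_linear_eq n (I : finType) (P : pred I) (j : I -> 'I_n) (t : R) :
  closed [set v : 'rV[R]_n | \sum_(i | P i) v ord0 (j i) = t].
Proof.
have sum_cont : continuous (fun v : 'rV[R]_n => \sum_(i | P i) v ord0 (j i)).
  apply: continuous_big; first exact: add_continuous.
  by move=> i _; exact: coord_continuous.
by move/continuous_closedP : sum_cont => /(_ [set s | s = t]); apply; exact: closed_eq.
Qed.

(** The couplings form a compact polytope, on which the cost is continuous. *)
Lemma optimal_coupling : exists2 p, couplings mu nu p &
  forall q, couplings mu nu q ->
    \sum_e c e.1 e.2 * p e <= \sum_e c e.1 e.2 * q e.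
Proof.
(* the compactness of boxes is applied to row vectors indexed by [X * X] *)
pose n := #|{: X * X}|.
pose toF (v : 'rV[R]_n) (e : X * X) := v ord0 (enum_rank e).
pose K := [set v | couplings mu nu (toF v)].
have ofF (p : X * X -> R) : toF (\row_i p (enum_val i)) = p.
  by apply/funext => e; rewrite /toF mxE enum_rankK.
have toK p : couplings mu nu p -> K (\row_i p (enum_val i)).
  by rewrite -{1}[p]ofF.
have K0 : K !=set0 by eexists; apply: toK product_coupling.
have clK : closed K.
  have -> : K = \bigcap_e [set v | 0 <= toF v e] `&` [set v | \sum_e toF v e = 1]
     `&` \bigcap_x [set v | \sum_y toF v (x, y) = mu x]
     `&` \bigcap_y [set v | \sum_x toF v (x, y) = nu y].
    apply/seteqP; split=> v /=.
      by move=> [[v0 v1] vr vc]; split; [split; [split|]|] => // e _;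
        [exact: v0|exact: vr|exact: vc].
    move=> [[[v0 v1] vr] vc]; split; [split=> // e|move=> x|move=> y].
    - exact: v0.
    - exact: vr.
    - exact: vc.
  apply: closedI; [apply: closedI; [apply: closedI|]|].
  - apply: closed_bigI => e _.
    have /continuous_closedP := @coord_continuous R 1 n ord0 (enum_rank e).
    by move=> /(_ [set t | 0 <= t]); apply; exact: closed_ge.
  - exact: closed_linear_eq.
  - by apply: closed_bigI => e _; exact: closed_linear_eq.
  - by apply: closed_bigI => e _; exact: closed_linear_eq.
have cK : compact K.
  pose A (_ : 'I_n) := `[0 : R, 1]%classic.
  apply: (@subclosed_compact _ K [set v : 'rV[R]_n | forall i, A i (v ord0 i)]) => //.
    by apply: rV_compact => i; exact: segment_compact.
  move=> v [[v0 v1] _ _] i; rewrite /A/= in_itv/=.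
  have := v0 (enum_val i); rewrite /toF enum_valK => -> /=.
  rewrite -v1 (bigD1 (enum_val i))//= /toF enum_valK lerDl sumr_ge0// => e _.
  exact: v0.
pose f (v : 'rV[R]_n) := \sum_e c e.1 e.2 * toF v e.
have fc : {within K, continuous f}.
  apply: continuous_subspaceT.
  apply: (@continuous_big _ _ _ 0 xpredT (@add_continuous R) _ _
    (fun e v => c e.1 e.2 * toF v e)) => e _.
  have ec : continuous (toF ^~ e) by exact: coord_continuous.
  exact: (fun w => continuousM (@cst_continuous _ _ (c e.1 e.2) w) (ec w)).
have [v] := compact_EVT_min K0 cK fc; rewrite inE => vK vmin.
exists (toF v) => // q qC; have := vmin (\row_i q (enum_val i)).
by rewrite /f ofF; apply; rewrite inE; exact: toK.
Qed.

End OptimalCoupling.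

Section FlowDuality.
Context {R : realType} {X : finType} (c : X -> X -> R) (E : {set X * X}).
Hypothesis c0 : forall x, c x x = 0.
Hypothesis ctri : forall x y z, c x z <= c x y + c y z.
Hypothesis geod : forall x y, exists2 p, dipaths E x y p & path_cost c x p = c x y.
Variables mu nu : X -> R.
Hypotheses (mu_prob : prob_vector mu) (nu_prob : prob_vector nu).

(** The mass [p (x, y)] travels along a path from [x] to [y] of cost [c x y]. *)
Lemma coupling_to_flow p : couplings mu nu p ->
  exists2 f, flows E (fun x => mu x - nu x) f &
    \sum_(e in E) c e.1 e.2 * f e = \sum_e c e.1 e.2 * p e.
Proof.
move=> [[p0 p1] prow pcol].
have /choice[g gP] (e : X * X) : exists g : X -> X -> R, [/\ forall u w, 0 <= g u w,
    forall u w, (u, w) \notin E -> g u w = 0,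
    forall u, outflow g u - inflow g u = (u == e.1)%:R - (u == e.2)%:R &
    plan_cost c g = c e.1 e.2].
  have [q [pq lq] cq] := geod e.1 e.2; have [g [g0 gE bal cg]] := path_flow c pq.
  by exists g; split=> //; [rewrite -lq|rewrite cg].
pose f (e : X * X) := \sum_t p t * g t e.1 e.2.
have fE e : e \notin E -> f e = 0.
  by case: e => u w uwE; rewrite /f big1// => t _;
    have [_ g_E _ _] := gP t; rewrite g_E ?mulr0.
exists f; last first.
  rewrite big_mkcond/=; transitivity (\sum_e c e.1 e.2 * f e).
    by apply: eq_bigr => e _; case: ifPn => // /fE ->; rewrite mulr0.
  under [LHS]eq_bigr => e _ do rewrite /f mulr_sumr.
  rewrite exchange_big/=; apply: eq_bigr => t _.
  have [_ _ _ <-] := gP t; rewrite -sum_pair_cost mulr_suml.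
  by apply: eq_bigr => e _; ring.
split=> [e _|u].
  by rewrite /f sumr_ge0// => t _; rewrite mulr_ge0//; have [] := gP t.
have ifE e : (if e \in E then f e else 0) = f e by case: ifPn => // /fE.
rewrite !(big_mkcond (fun v => (_, v) \in E))/= !(big_mkcond (fun v => (v, _) \in E))/=.
have -> : \sum_v (if (u, v) \in E then f (u, v) else 0) = \sum_t p t * outflow (g t) u.
  under [RHS]eq_bigr do rewrite mulr_sumr.
  by rewrite exchange_big/=; apply: eq_bigr => v _; rewrite ifE.
have -> : \sum_v (if (v, u) \in E then f (v, u) else 0) = \sum_t p t * inflow (g t) u.
  under [RHS]eq_bigr do rewrite mulr_sumr.
  by rewrite exchange_big/=; apply: eq_bigr => v _; rewrite ifE.
rewrite -sumrB; under eq_bigr => t _.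
  rewrite -mulrBr; have [_ _ -> _] := gP t; rewrite mulrBr; over.
rewrite sumrB -prow -pcol; congr (_ - _).
  transitivity (\sum_x \sum_y p (x, y) * (u == x)%:R).
    by rewrite pair_bigA; apply: eq_bigr => -[].
  under eq_bigr => x _ do rewrite -mulr_suml mulrC eq_sym.
  by rewrite sum_pick.
transitivity (\sum_x \sum_y p (x, y) * (u == y)%:R).
  by rewrite pair_bigA; apply: eq_bigr => -[].
rewrite exchange_big/=.
under eq_bigr => x _ do rewrite -mulr_suml mulrC eq_sym.
by rewrite sum_pick.
Qed.

(** Extended by zero outside [E], the flow is a mass plan on all pairs of
    vertices, to which the triangle inequality applies. *)
Lemma flow_to_coupling f : flows E (fun x => mu x - nu x) f ->
  exists2 p, couplings mu nu p &
    \sum_e c e.1 e.2 * p e <= \sum_(e in E) c e.1 e.2 * f e.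
Proof.
move=> [f0 bal]; have [mu0 mu1] := mu_prob; have [nu0 nu1] := nu_prob.
pose g u w := if (u, w) \in E then f (u, w) else 0.
have g0 u w : 0 <= g u w by rewrite /g; case: ifP => // /f0.
have gbal u : outflow g u - inflow g u = mu u - nu u.
  by rewrite -bal /outflow /inflow /g -!big_mkcond.
have [h [h0 ch hr hc]] := flow_to_plan c0 ctri mu0 nu0 g0 gbal.
exists (fun e => h e.1 e.2); last first.
  rewrite sum_pair_cost (le_trans ch)// -sum_pair_cost [leRHS]big_mkcond/=.
  by apply: ler_sum => -[u w] _; rewrite /g/=; case: ifP => //; rewrite mulr0.
split=> //; split=> [e//|]; rewrite -(pair_bigA _ h)/= -mu1.
by apply: eq_bigr => x _; exact: hr.
Qed.

Lemma wasserstein_flow_cost :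
  wasserstein c mu nu = flow_cost E c (fun x => mu x - nu x).
Proof.
have [p pC pmin] := optimal_coupling c mu_prob nu_prob.
have -> : wasserstein c mu nu = \sum_e c e.1 e.2 * p e.
  have lb : lbound [set \sum_e c e.1 e.2 * q e | q in couplings mu nu]
      (\sum_e c e.1 e.2 * p e) by move=> _ [q qC <-]; exact: pmin.
  apply/le_anti/andP; split.
    by apply: ge_inf; [exists (\sum_e c e.1 e.2 * p e)|exists p].
  by apply: lb_le_inf => //; exists (\sum_e c e.1 e.2 * p e), p.
apply/esym/minimum_eq; first by have [f fF <-] := coupling_to_flow pC; exists f.
move=> _ [f /flow_to_coupling[q qC cq] <-]; exact: le_trans (pmin q qC) cq.
Qed.

End FlowDuality.

(** * The sum of the inverse squares *)

Section Basel.
Context {R : realType}.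
Implicit Types x : R.

(** By the mean value theorem [sin x / x] is a value of the decreasing function
    [cos] on [[0, x]]. *)
Lemma sin_bounds x : 0 < x < pi / 2 -> x * cos x <= sin x <= x.
Proof.
move=> /andP[x0 xpi].
have pi0 : 0 < (pi : R) by exact: pi_gt0.
have [y /andP[y0 yx]] : exists2 y, (0 <= y) && (y <= x) & sin x - sin 0 = cos y * (x - 0).
  have [|y yx ->] := @MVT_segment R (@sin R) (@cos R) 0 x (ltW x0).
  - by apply: continuous_subspaceT; exact: continuous_sin.
  - by exists y => //; move: yx; rewrite in_itv.
rewrite sin0 !subr0 => ->; apply/andP; split; last first.
  by rewrite ler_piMl ?cos_le1// ltW.
rewrite mulrC ler_wpM2r ?(ltW x0)//; move: yx; rewrite le_eqVlt => /predU1P[->//|yx].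
rewrite ltW// ltr_cos// in_itv/=; apply/andP; split; lra.
Qed.

(** [1 / x^2] lies between [cot^2 x] and [1 / sin^2 x], which differ by exactly
    [1]. *)
Lemma inv_sqr_bounds x : 0 < x < pi / 2 ->
  (sin x) ^- 2 - 1 <= x ^- 2 <= (sin x) ^- 2.
Proof.
move=> x0pi; have /andP[x0 xpi] := x0pi.
have s0 : 0 < sin x by exact: sin_gt0_pihalf.
have c0 : 0 < cos x by apply: cos_gt0_pihalf; lra.
have /andP[xc sx] := sin_bounds x0pi.
apply/andP; split; last first.
  by rewrite lef_pV2 ?posrE ?exprn_gt0// ler_pXn2r// ?nnegrE ?(ltW s0) ?(ltW x0).
have -> : (sin x) ^- 2 - 1 = (cos x / sin x) ^+ 2.
  by rewrite expr_div_n cos2sin2; field; rewrite gt_eqF.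
rewrite -exprVn ler_pXn2r// ?nnegrE ?divr_ge0 ?invr_ge0 ?(ltW s0) ?(ltW c0) ?(ltW x0)//.
by rewrite ler_pdivrMr// mulrC ler_pdivlMr// mulrC.
Qed.

Lemma sum_fold (F : nat -> R) M : \sum_(0 <= k < M.*2) F k =
  \sum_(0 <= k < M) (F k + F (M.*2.-1 - k)%N).
Proof.
rewrite big_split/= -addnn (@big_cat_nat _ _ _ M)//= ?leq_addr//; congr (_ + _).
rewrite [RHS]big_nat_rev/= -{1}[M]add0n big_addn addnK.
by apply: eq_big_nat => k /andP[_ kM]; congr F; lia.
Qed.

Let angle n k : R := (k.*2.+1)%:R * pi / 2 ^+ n.+2.

Lemma angle_range n k : (k < 2 ^ n)%N -> 0 < angle n k < pi / 2.
Proof.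
move=> kn; have pi0 : 0 < (pi : R) by exact: pi_gt0.
rewrite /angle divr_gt0 ?exprn_gt0 ?mulr_gt0//=.
have -> : (pi : R) / 2 = (2 ^+ n.+1 * pi) / 2 ^+ n.+2.
  by rewrite !exprS; field; rewrite expf_eq0 pnatr_eq0 andbF.
rewrite ltr_pM2r ?invr_gt0 ?exprn_gt0// ltr_pM2r// -natrX ltr_nat expnS; lia.
Qed.

(** Pairing the angles [t] and [pi / 2 - t] turns [sin t] into [cos t], and
    [1 / sin^2 t + 1 / cos^2 t = 4 / sin^2 (2 t)] halves the number of terms. *)
Lemma sum_inv_sin2 n :
  \sum_(0 <= k < 2 ^ n) (sin (angle n k)) ^- 2 = 2 * 4 ^+ n :> R.
Proof.
elim: n => [|n IH].
  rewrite big_nat1 /angle mul1r mulr1.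
  have h : cos ((pi : R) / 4 *+ 2) = 0.
    by rewrite -[RHS](@cos_pihalf R); congr cos; field.
  have := sin2cos2 ((pi : R) / 4); move: h; rewrite cos_mulr2n.
  rewrite (_ : 2 ^+ 2 = 4); last by ring.
  move=> h1 h2; have -> : sin ((pi : R) / 4) ^+ 2 = 2^-1 by lra.
  by rewrite invrK.
rewrite expnS mul2n sum_fold [in RHS]exprS mulrCA -IH mulr_sumr.
apply: eq_big_nat => k /andP[_ kn].
have -> : angle n.+1 ((2 ^ n).*2.-1 - k) = pi / 2 - angle n.+1 k.
  rewrite /angle.
  have -> : ((2 ^ n).*2.-1 - k).*2.+1 = ((2 ^ n) * 4 - k.*2.+1)%N by lia.
  rewrite natrB; last by lia.
  rewrite natrM natrX !exprS; field.
  by rewrite expf_eq0 pnatr_eq0 andbF.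
have -> : angle n k = angle n.+1 k *+ 2.
  by rewrite /angle !exprS; field; rewrite expf_eq0 pnatr_eq0 andbF.
have /andP[t0 tpi] : 0 < angle n.+1 k < pi / 2.
  by apply: angle_range; rewrite expnS; lia.
set t := angle n.+1 k in t0 tpi *.
have s0 : 0 < sin t by rewrite sin_gt0_pihalf// t0.
have c0 : 0 < cos t by apply: cos_gt0_pihalf; lra.
rewrite sinB cos_pihalf sin_pihalf mul0r mul1r subr0 sin_mulr2n.
rewrite (_ : _ + _ = (cos t ^+ 2 + sin t ^+ 2) / (cos t * sin t) ^+ 2).
  by rewrite cos2Dsin2; field; rewrite !gt_eqF.
by field; rewrite !gt_eqF.
Qed.

Definition odd_zeta2 m : R := \sum_(0 <= k < m) (k.*2.+1)%:R ^- 2.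
Definition zeta2 m : R := \sum_(0 <= k < m) k.+1%:R ^- 2.

(** Replacing [1 / sin^2] by the inverse square of the angle in [sum_inv_sin2]
    costs at most [1] for each of the [2^n] terms, negligible against the total
    [2 * 4^n]. *)
Lemma odd_zeta2_bounds n :
  pi ^+ 2 / 8 - pi ^+ 2 / 16 / 2 ^+ n <= odd_zeta2 (2 ^ n) <= pi ^+ 2 / 8.
Proof.
have pi0 : 0 < (pi : R) by exact: pi_gt0.
have two0 : 0 < (2 : R) ^+ n by rewrite exprn_gt0.
have four : (4 : R) ^+ n = 2 ^+ n * 2 ^+ n by rewrite -exprMn; congr (_ ^+ n); ring.
pose T := \sum_(0 <= k < 2 ^ n) (angle n k) ^- 2.
have TE : T = 16 * 4 ^+ n / pi ^+ 2 * odd_zeta2 (2 ^ n).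
  rewrite /T /odd_zeta2 mulr_sumr; apply: eq_bigr => k _.
  have -> : (16 : R) * 4 ^+ n = (2 ^+ n.+2) ^+ 2.
    by rewrite four !exprS; ring.
  rewrite /angle; have : (k.*2.+1)%:R != 0 :> R by rewrite pnatr_eq0.
  have : 0 < (2 : R) ^+ n.+2 by rewrite exprn_gt0.
  move: (pi) pi0 (k.*2.+1%:R) (2 ^+ n.+2) => p p0 a t t0 a0.
  by field; rewrite a0 !gt_eqF.
have Tle : T <= 2 * 4 ^+ n.
  rewrite -sum_inv_sin2; apply: ler_sum_nat => k /andP[_ kn].
  by have /andP[] := inv_sqr_bounds (angle_range kn).
have Tge : 2 * 4 ^+ n - 2 ^+ n <= T.
  have -> : (2 : R) ^+ n = \sum_(0 <= k < 2 ^ n) 1.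
    by rewrite big_const_nat iter_addr addr0 subn0 natrX.
  rewrite -sum_inv_sin2 -sumrB; apply: ler_sum_nat => k /andP[_ kn].
  by have /andP[] := inv_sqr_bounds (angle_range kn).
have -> : odd_zeta2 (2 ^ n) = pi ^+ 2 / 16 / 4 ^+ n * T.
  rewrite TE four; move: (pi) pi0 (2 ^+ n) two0 => p p0 t t0.
  by field; rewrite !gt_eqF.
have c0 : 0 <= pi ^+ 2 / 16 / 4 ^+ n :> R.
  by rewrite divr_ge0 ?exprn_ge0// divr_ge0 ?exprn_ge0// ltW.
apply/andP; split.
  apply: le_trans (ler_wpM2l c0 Tge); rewrite four le_eqVlt; apply/orP; left.
  by apply/eqP; move: (pi) (2 ^+ n) two0 => p t t0; field; rewrite gt_eqF.
apply: (le_trans (ler_wpM2l c0 Tle)); rewrite four le_eqVlt; apply/orP; left.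
by apply/eqP; move: (pi) (2 ^+ n) two0 => p t t0; field; rewrite gt_eqF.
Qed.

(** The even squares contribute a quarter of the shorter sum. *)
Lemma zeta2_double m : zeta2 m.*2 = zeta2 m / 4 + odd_zeta2 m.
Proof.
elim: m => [|m IH]; first by rewrite /zeta2 /odd_zeta2 !big_nil mul0r addr0.
rewrite doubleS /zeta2 /odd_zeta2 !big_nat_recr//= -/(zeta2 _) -/(zeta2 _) -/(odd_zeta2 _).
have -> : (m.*2.+2)%:R = 2 * m.+1%:R :> R by rewrite -natrM; congr _%:R; lia.
rewrite IH; have : m.+1%:R != 0 :> R by rewrite pnatr_eq0.
have : (m.*2.+1)%:R != 0 :> R by rewrite pnatr_eq0.
move: (m.+1%:R) (m.*2.+1%:R) => a b b0 a0; field; rewrite a0 b0.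
by [].
Qed.

Lemma zeta2_le m n : (m <= n)%N -> zeta2 m <= zeta2 n.
Proof.
move=> mn; rewrite /zeta2 [leRHS](big_cat_nat (leq0n m))//= lerDl sumr_ge0// => k _.
by rewrite invr_ge0 exprn_ge0.
Qed.

(** By [zeta2_double] and [odd_zeta2_bounds] the error [e_n] at [2^n] satisfies
    [e_(n+1) <= e_n / 4 + (pi^2 / 16) / 2^n], an induction that closes with
    [e_n <= (pi^2 / 4) / 2^n]. *)
Lemma zeta2_pow2_bounds n :
  pi ^+ 2 / 6 - pi ^+ 2 / 4 / 2 ^+ n <= zeta2 (2 ^ n) <= pi ^+ 2 / 6.
Proof.
elim: n => [|n /andP[IHl IHr]].
  (* the single term of the odd sum gives [pi^2 >= 8], hence [1 <= pi^2 / 6] *)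
  have /andP[_] := odd_zeta2_bounds 0.
  have p2 : 0 <= (pi : R) ^+ 2 by rewrite exprn_ge0// pi_ge0.
  rewrite /odd_zeta2 /zeta2 !big_nat1 expr1n invr1.
  by move: (pi ^+ 2) p2 => p p0 ?; apply/andP; split; lra.
have /andP[] := odd_zeta2_bounds n.
rewrite expnS mul2n zeta2_double [2 ^+ n.+1]exprS invfM.
have p2 : 0 <= (pi : R) ^+ 2 / 2 ^+ n by rewrite divr_ge0 ?exprn_ge0// pi_ge0.
move: (pi ^+ 2) (2 ^+ n)^-1 IHl IHr p2 => p q *.
apply/andP; split; lra.
Qed.

Lemma zeta2_le_lim m : zeta2 m <= pi ^+ 2 / 6.
Proof.
have /andP[_] := zeta2_pow2_bounds m; apply: le_trans.
by apply: zeta2_le; rewrite ltnW// ltn_expl.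
Qed.

Lemma zeta2_near_lim (e : R) : 0 < e -> exists m, pi ^+ 2 / 6 - e <= zeta2 m.
Proof.
move=> e0; have q0 : 0 <= pi ^+ 2 / 4 / e by rewrite !divr_ge0 ?exprn_ge0 ?pi_ge0// ltW.
have [n hn] : exists n : nat, pi ^+ 2 / 4 / e <= n%:R.
  by exists (Num.trunc (pi ^+ 2 / 4 / e)).+1; rewrite ltW// truncnS_gt.
exists (2 ^ n)%N; have /andP[+ _] := zeta2_pow2_bounds n; apply: le_trans.
rewrite lerD2l lerN2 ler_pdivrMr ?exprn_gt0// [e * _]mulrC -ler_pdivrMr//.
by rewrite (le_trans hn)// -natrX ler_nat ltnW// ltn_expl.
Qed.

(** Keeping [1] and [1 / 4] and telescoping [1 / k^2 <= 1 / (k - 1) - 1 / k] for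
    the other terms.  What matters below is that the bound is less than [2]. *)
Lemma zeta2_lim_le : pi ^+ 2 / 6 <= 7 / 4 :> R.
Proof.
have bound m : zeta2 m.+2 <= 7 / 4 - m.+2%:R ^-1.
  elim: m => [|m IH]; first by rewrite /zeta2 !big_nat_recr//= big_nil; lra.
  rewrite /zeta2 big_nat_recr//= -/(zeta2 _) (le_trans (lerD IH (lexx _)))//.
  have m2 : 0 < m.+2%:R :> R by [].
  have m3 : (m.+3)%:R = m.+2%:R + 1 :> R by rewrite -natr1.
  rewrite m3; move: (m.+2%:R) m2 => a a0.
  rewrite -subr_ge0 [leRHS](_ : _ = (a * (a + 1) ^+ 2)^-1).
    by rewrite invr_ge0 mulr_ge0 ?exprn_ge0// ltW// addr_gt0.
  field; rewrite !gt_eqF// addr_gt0//.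
apply/ler_addgt0Pr => e e0; have [m] := zeta2_near_lim e0.
rewrite lerBlDr => /le_trans; apply; rewrite lerD2r.
have m2 : (m <= m.+2)%N by lia.
apply: (le_trans (zeta2_le m2)); rewrite (le_trans (bound m))// gerBl.
by rewrite invr_ge0.
Qed.

End Basel.

(** * Sums over coprime pairs *)

Section CoprimeCount.
Local Open Scope nat_scope.

Definition line_sum N d := \sum_(1 <= a < N.+1) (N - d * a).
(** The differences are truncated, so only [a, b <= N / d] count: up to the factor
    [d^2] this is the sum for [d = 1] at the real scale [N / d]. *)
Definition coprime_sum N d :=
  \sum_(1 <= a < N.+1) \sum_(1 <= b < N.+1) coprime a b * ((N - d * a) * (N - d * b)).

(** With [x_a] the truncated difference [N - d a], the squares telescope:
    [2 d x_a <= x_(a-1)^2 - x_a^2 <= d (x_(a-1) + x_a)]. *)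
Lemma line_sum_bounds N d : 0 < d ->
  2 * d * line_sum N d <= N ^ 2 <= 2 * d * line_sum N d + d * N.
Proof.
move=> d0; have step K : let S := \sum_(1 <= a < K.+1) (N - d * a) in
    2 * d * S + (N - d * K) ^ 2 <= N ^ 2 /\
    N ^ 2 + d * (N - d * K) <= 2 * d * S + d * N + (N - d * K) ^ 2.
  elim: K => [|K []] /=; first by rewrite big_geq// !muln0 subn0; split; lia.
  rewrite (big_nat_recr K.+1)//=; set S := \sum_(1 <= a < K.+1) _.
  have [dK|dK] := leqP (d * K.+1) N.
    have -> : N - d * K = N - d * K.+1 + d by lia.
    by move: (N - d * K.+1) => x h1 h2; split; nia.
  have -> : N - d * K.+1 = 0 by lia.
  have : N - d * K <= d by lia.
  by move: (N - d * K) => x xd h1 h2; split; nia.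
have [] := step N; rewrite -/(line_sum N d).
have -> : N - d * N = 0 by apply/eqP; rewrite subn_eq0 leq_pmull.
lia.
Qed.

Lemma sum_multiples (G : nat -> nat) k N : 0 < k -> (forall a, N < a -> G a = 0) ->
  \sum_(1 <= a < N.+1) (k %| a) * G a = \sum_(1 <= a < N.+1) G (k * a).
Proof.
move=> k0 G0.
have part M : \sum_(1 <= a < M.+1) (k %| a) * G a =
    \sum_(1 <= a < (M %/ k).+1) G (k * a).
  elim: M => [|M IH]; first by rewrite div0n !big_geq.
  rewrite big_nat_recr//= IH divnS//; case: (boolP (k %| M.+1)) => kM.
    rewrite add1n [RHS]big_nat_recr//= mul1n; congr (_ + G _).
    by have := divnS M k0; rewrite kM add1n => <-; rewrite mulnC divnK.
  by rewrite add0n mul0n addn0.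
rewrite part [RHS](@big_cat_nat _ _ _ (N %/ k).+1)//=; last by rewrite ltnS leq_div.
rewrite [X in _ + X]big_nat_cond [X in _ + X]big1 ?addn0// => a /andP[/andP[Na _] _].
by apply: G0; rewrite mulnC -ltn_divLR.
Qed.

(** Each pair of positive integers is, in exactly one way, a multiple of a
    coprime pair, the factor being its gcd. *)
Lemma sum_by_gcd (F : nat -> nat -> nat) N :
  (forall a b, N < a -> F a b = 0) -> (forall a b, N < b -> F a b = 0) ->
  \sum_(1 <= a < N.+1) \sum_(1 <= b < N.+1) F a b =
  \sum_(1 <= k < N.+1) \sum_(1 <= a < N.+1) \sum_(1 <= b < N.+1)
    coprime a b * F (k * a) (k * b).
Proof.
move=> F1 F2; transitivity (\sum_(1 <= k < N.+1) \sum_(1 <= a < N.+1)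
    \sum_(1 <= b < N.+1) (gcdn a b == k) * F a b).
  rewrite [RHS]exchange_big_nat/=; apply: eq_big_nat => a /andP[a0 aN].
  rewrite [RHS]exchange_big_nat/=; apply: eq_big_nat => b /andP[b0 bN].
  have gr : gcdn a b \in index_iota 1 N.+1.
    by rewrite mem_index_iota gcdn_gt0 a0 (leq_ltn_trans _ aN)// dvdn_leq// dvdn_gcdl.
  rewrite (bigD1_seq (gcdn a b))//= ?iota_uniq// eqxx mul1n big1 ?addn0// => k.
  by rewrite eq_sym => /negPf->.
apply: eq_big_nat => k /andP[k0 _].
transitivity (\sum_(1 <= a < N.+1) (k %| a) * \sum_(1 <= b < N.+1) (k %| b) *
    ((gcdn a b == k) * F a b)).
  apply: eq_bigr => a _; rewrite big_distrr/=; apply: eq_bigr => b _.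
  have [<-|] := eqVneq; last by rewrite !mul0n !muln0.
  by rewrite dvdn_gcdl dvdn_gcdr !mul1n.
rewrite sum_multiples//; last first.
  by move=> a Na; rewrite big1// => b _; rewrite F1// !muln0.
apply: eq_bigr => a _; rewrite sum_multiples//; last first.
  by move=> b Nb; rewrite F2// !muln0.
apply: eq_bigr => b _; rewrite -muln_gcdr -[X in _ == X]muln1 eqn_pmul2l//.
Qed.

(** The multiples by [k] of the coprime pairs contribute the coprime sum with
    [d k] in place of [d]; this identity is what determines the density. *)
Lemma line_sum_sqr N d : 0 < d ->
  line_sum N d ^ 2 = \sum_(0 <= k < N) coprime_sum N (d * k.+1).
Proof.
move=> d0; rewrite -mulnn {1}/line_sum big_distrl/=.
under eq_bigr => a _ do rewrite /line_sum big_distrr/=.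
rewrite (sum_by_gcd (F := fun a b => (N - d * a) * (N - d * b))).
- rewrite big_add1/=; apply: eq_bigr => k _; apply: eq_bigr => a _.
  by apply: eq_bigr => b _; rewrite !mulnA.
- by move=> a b Na; rewrite (_ : N - d * a = 0)//; nia.
- by move=> a b Nb; rewrite (_ : N - d * b = 0)//; nia.
Qed.

(** Among the pairs of numbers below [N], the distance [a > 0] occurs
    [2 (N - a)] times and the distance [0] occurs [N] times. *)
Lemma sum_differences (G : nat -> nat) N :
  \sum_(x < N) \sum_(y < N) G `|y%:Z - x%:Z| =
  N * G 0 + 2 * \sum_(1 <= a < N.+1) (N - a) * G a.
Proof.
transitivity (\sum_(0 <= x < N) \sum_(0 <= y < N) G `|y%:Z - x%:Z|).
  by rewrite big_mkord; apply: eq_bigr => x _; rewrite big_mkord.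
elim: N => [|N IH]; first by rewrite !big_geq.
rewrite big_nat_recr//= big_nat_recr//= subrr absz0.
under eq_bigr => x _ do rewrite big_nat_recr//=.
rewrite big_split/= IH.
have corner (H : nat -> nat) : (forall x, x < N -> H x = G (N - x)) ->
    \sum_(0 <= x < N) H x = \sum_(1 <= a < N.+1) G a.
  move=> HG; rewrite big_nat_rev/= big_add1/=; apply: eq_big_nat => x /andP[_ xN].
  by rewrite HG; [congr G|]; lia.
rewrite !corner; [|by move=> x xN; congr G; lia|by move=> x xN; congr G; lia].
have -> : \sum_(1 <= a < N.+2) (N.+1 - a) * G a =
    \sum_(1 <= a < N.+1) (N - a) * G a + \sum_(1 <= a < N.+1) G a.
  rewrite big_nat_recr//= subnn mul0n addn0 -big_split/=.
  by apply: eq_big_nat => a aN; rewrite subSn ?mulSn; lia.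
lia.
Qed.

Lemma sum_coprime0 N : 1 < N ->
  \sum_(1 <= b < N.+1) (N - b) * coprime 0 b = N.-1.
Proof.
move=> N1; rewrite big_ltn ?ltnS 1?ltnW// /coprime gcd0n muln1 subn1.
rewrite big_nat_cond big1 ?addn0// => b; rewrite gcd0n; case: eqP => [->|]//.
by rewrite muln0.
Qed.

(** The first term counts the displacements with nonzero coordinates, in the four
    quadrants; the second one the four axis steps. *)
Lemma sum_coprime_differences N : 1 < N ->
  \sum_(x1 < N) \sum_(y1 < N) \sum_(x2 < N) \sum_(y2 < N)
     coprime `|y1%:Z - x1%:Z| `|y2%:Z - x2%:Z|
  = 4 * coprime_sum N 1 + 4 * (N * N.-1).
Proof.
move=> N1.
under eq_bigr => x1 _ do under eq_bigr => y1 _ do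
  rewrite (sum_differences (fun b => coprime `|y1%:Z - x1%:Z| b) N).
rewrite (sum_differences (fun a => N * coprime a 0 + 2 *
   \sum_(1 <= b < N.+1) (N - b) * coprime a b) N) sum_coprime0//=.
under eq_bigr => a _ do rewrite mulnDr mulnCA [_ * (2 * _)]mulnCA coprime_sym.
rewrite big_split/= -!big_distrr/= sum_coprime0//.
have -> : \sum_(1 <= a < N.+1) (N - a) * (\sum_(1 <= b < N.+1) (N - b) * coprime a b)
    = coprime_sum N 1.
  apply: eq_bigr => a _; rewrite big_distrr/=; apply: eq_bigr => b _.
  by rewrite !mul1n mulnA mulnC.
lia.
Qed.

End CoprimeCount.

(** * The density of the edges *)

Section Contraction.
Context {R : realType}.
(** [h N d] is to be thought of as a function of [N / d]; the hypotheses say that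
    its sum over the scales [N / (d (k + 1))], weighted by [1 / (k + 1)^2], is close
    to [1] when [N / d] is large. *)
Variable h : nat -> nat -> R.
Hypothesis h_ge0 : forall N d, 0 <= h N d.

Let T N d := \sum_(0 <= k < N) h N (d * k.+1) * k.+1%:R ^- 2.

Hypothesis T_le1 : forall N d, (0 < N)%N -> (0 < d)%N -> T N d <= 1.
Hypothesis T_ge : forall N d, (0 < N)%N -> (0 < d)%N -> 1 - 2 * (d%:R / N%:R) <= T N d.

Let l : R := (pi ^+ 2 / 6)^-1.

Lemma zeta2_lim_ge1 : 1 <= pi ^+ 2 / 6 :> R.
Proof.
by have := @zeta2_le_lim R 1; rewrite /zeta2 big_nat1 expr1n invr1.
Qed.

Lemma limit_bounds : 0 < l <= 1.
Proof.
have z1 := zeta2_lim_ge1; have z0 : 0 < pi ^+ 2 / 6 :> R by exact: lt_le_trans z1.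
by rewrite /l invr_gt0 z0 invf_le1.
Qed.

Lemma deviation_le1 N d : (0 < N)%N -> (0 < d)%N -> `|h N d - l| <= 1.
Proof.
move=> N0 d0; have /andP[l0 l1] := limit_bounds.
have hT : h N d <= T N d.
  rewrite /T big_ltn// muln1 expr1n invr1 mulr1 lerDl sumr_ge0// => k _.
  by rewrite mulr_ge0// invr_ge0 exprn_ge0.
have h1 := le_trans hT (T_le1 N0 d0); have h0 := h_ge0 N d.
by rewrite ler_norml; apply/andP; split; lra.
Qed.

(** The first term of [T N d] is [h N d] itself.  Among the others, those with
    [k < K] still have a large ratio [N / (d (k + 1))], so the bound [B] applies to
    them and their weights sum to at most [3 / 4]; those beyond have small total weight
    and deviation at most [1]. *)
Lemma contraction_step (B : R) : 0 < B ->
  (exists X, forall N d, (0 < N)%N -> (0 < d)%N -> (X * d <= N)%N ->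
     `|h N d - l| <= B) ->
  exists X, forall N d, (0 < N)%N -> (0 < d)%N -> (X * d <= N)%N ->
     `|h N d - l| <= 7 / 8 * B.
Proof.
move=> B0 [X HX]; have /andP[l0 l1] := limit_bounds.
(* three errors of size [e] arise, and [3 / 4 * B + 3 * e = 7 / 8 * B] *)
pose e := B / 24; have e0 : 0 < e by rewrite divr_gt0.
have [K0 hK0] := zeta2_near_lim e0.
pose K := K0.+1; have hK : pi ^+ 2 / 6 - e <= zeta2 K :> R.
  by apply: (le_trans hK0); apply: zeta2_le.
have [Y hY] : exists Y : nat, 2 / e <= Y%:R.
  by exists (Num.trunc (2 / e)).+1; rewrite ltW// truncnS_gt.
exists (X * K + Y + K)%N => N d N0 d0 XN.
have XKN : (X * K * d <= N)%N.
  by apply: leq_trans XN; rewrite leq_mul2r -addnA leq_addr orbT.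
have YN : (Y * d <= N)%N.
  by apply: leq_trans XN; rewrite leq_mul2r -addnA addnCA leq_addr orbT.
have KN : (K <= N)%N.
  by apply: leq_trans XN; rewrite (leq_trans (leq_addl (X * K + Y) K))// leq_pmulr.
have dN : 2 * (d%:R / N%:R) <= e.
  rewrite mulrA ler_pdivrMr ?ltr0n//.
  have : Y%:R * d%:R <= N%:R :> R by rewrite -natrM ler_nat.
  move: hY; rewrite ler_pdivrMr// => hY /(ler_wpM2l (ltW e0)); apply: le_trans.
  by rewrite mulrA ler_wpM2r// mulrC.
have NK : zeta2 K <= zeta2 N :> R by apply: zeta2_le.
have Nz := @zeta2_le_lim R N.
have split_first (F : nat -> R) M : (0 < M)%N ->
   \sum_(0 <= k < M) F k = F 0%N + \sum_(1 <= k < M) F k.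
  by move=> M0; rewrite big_ltn.
pose r (k : nat) : R := k.+1%:R ^- 2.
have r0 k : 0 <= r k by rewrite invr_ge0 exprn_ge0.
have rK : \sum_(1 <= k < K) r k <= 3 / 4.
  have : zeta2 K <= 7 / 4 :> R := le_trans (zeta2_le_lim K) zeta2_lim_le.
  rewrite /zeta2 split_first// expr1n invr1 -/(r _); lra.
have rN : \sum_(K <= k < N) r k <= e.
  have : zeta2 N = zeta2 K + \sum_(K <= k < N) r k.
    by rewrite /zeta2 (big_cat_nat (leq0n K)).
  lra.
have tail : `|\sum_(1 <= k < N) (h N (d * k.+1) - l) * r k| <= 3 / 4 * B + e.
  rewrite (big_cat_nat (n := K))//= (le_trans (ler_normD _ _))// lerD//.
    apply: (@le_trans _ _ (\sum_(1 <= k < K) B * r k)); last first.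
      by rewrite -mulr_sumr mulrC ler_wpM2r// ltW.
    rewrite (le_trans (ler_norm_sum _ _ _))//; apply: ler_sum_nat => k /andP[_ kK].
    rewrite normrM (ger0_norm (r0 k)) ler_wpM2r//; apply: HX; rewrite ?muln_gt0 ?d0//.
    apply: leq_trans XKN; rewrite mulnA mulnAC leq_mul2r leq_mul2l kK !orbT//.
  apply: le_trans rN; rewrite (le_trans (ler_norm_sum _ _ _))//; apply: ler_sum_nat => k _.
  by rewrite normrM (ger0_norm (r0 k)) ler_piMl// deviation_le1// muln_gt0 d0.
have main : h N d - l = (T N d - 1) + (1 - l * zeta2 N)
    - \sum_(1 <= k < N) (h N (d * k.+1) - l) * r k.
  have -> : T N d = h N d + \sum_(1 <= k < N) h N (d * k.+1) * r k.
    by rewrite /T split_first// muln1 expr1n invr1 mulr1.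
  have -> : zeta2 N = 1 + \sum_(1 <= k < N) r k.
    by rewrite /zeta2 split_first// expr1n invr1.
  have -> : \sum_(1 <= k < N) (h N (d * k.+1) - l) * r k =
      \sum_(1 <= k < N) h N (d * k.+1) * r k - l * \sum_(1 <= k < N) r k.
    by rewrite mulr_sumr -sumrB; apply: eq_bigr => k _; rewrite mulrBl.
  ring.
have lz : 0 <= 1 - l * zeta2 N <= e.
  have lz1 : l * (pi ^+ 2 / 6) = 1.
    by rewrite mulVf// gt_eqF// (lt_le_trans _ zeta2_lim_ge1).
  rewrite -{1 2}lz1 -mulrBr mulr_ge0 ?subr_ge0 ?(ltW l0)//=.
  rewrite (@le_trans _ _ (pi ^+ 2 / 6 - zeta2 N))//; last lra.
  by rewrite ler_piMl// subr_ge0.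
have T1 := T_le1 N0 d0; have T2 := T_ge N0 d0.
move: tail; rewrite main !ler_norml.
have -> : B = 24 * e by rewrite /e; field.
move: lz => /andP[? ?] /andP[? ?]; apply/andP; split; lra.
Qed.

Lemma contraction_limit (e : R) : 0 < e ->
  exists X, forall N d, (0 < N)%N -> (0 < d)%N -> (X * d <= N)%N -> `|h N d - l| <= e.
Proof.
move=> e0.
have iter n : exists X, forall N d, (0 < N)%N -> (0 < d)%N -> (X * d <= N)%N ->
    `|h N d - l| <= (7 / 8) ^+ n.
  elim: n => [|n IH]; first by exists 0%N => N d N0 d0 _; exact: deviation_le1.
  by rewrite exprS; apply: contraction_step => //; rewrite exprn_gt0// divr_gt0.
have q1 : `|7 / 8| < 1 :> R by rewrite ger0_norm ?divr_ge0// ltr_pdivrMr// mul1r ltr_nat.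
have /cvgr0_norm_le /(_ e e0)[n _ /(_ n (leqnn n)) /= hn] := cvg_expr q1.
have [X HX] := iter n; exists X => N d N0 d0 XN.
by rewrite (le_trans (HX N d N0 d0 XN))// (le_trans _ hn)// ler_norm.
Qed.

End Contraction.

Section Density.
Context {R : realType}.

(** Normalized by the number [N^4 / (4 d^2)] to which the sum over all pairs is
    asymptotic. *)
Definition coprime_density N d : R :=
  4 * d%:R ^+ 2 * (coprime_sum N d)%:R / N%:R ^+ 4.

Lemma coprime_density_sum N d : (0 < N)%N -> (0 < d)%N ->
  \sum_(0 <= k < N) coprime_density N (d * k.+1) * k.+1%:R ^- 2
  = ((2 * d * line_sum N d)%N%:R / N%:R ^+ 2) ^+ 2.
Proof.
move=> N0 d0; transitivity (4 * d%:R ^+ 2 * (line_sum N d ^ 2)%:R / N%:R ^+ 4 : R).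
  rewrite line_sum_sqr// natr_sum mulr_sumr mulr_suml; apply: eq_bigr => k _.
  rewrite /coprime_density natrM.
  have : k.+1%:R != 0 :> R by rewrite pnatr_eq0.
  have : N%:R != 0 :> R by rewrite pnatr_eq0 -lt0n.
  move: (k.+1%:R) (N%:R) => a b b0 a0.
  by field; rewrite a0 b0.
rewrite natrX !natrM; field.
by rewrite pnatr_eq0 -lt0n.
Qed.

Lemma line_ratio_bounds N d : (0 < N)%N -> (0 < d)%N ->
  let u : R := (2 * d * line_sum N d)%N%:R / N%:R ^+ 2 in
  0 <= u <= 1 /\ 1 - d%:R / N%:R <= u.
Proof.
move=> N0 d0 /=; have /andP[] := line_sum_bounds N d0.
set s := (2 * d * line_sum N d)%N; rewrite -!(@ler_nat R) natrD natrM natrX.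
have NR : 0 < N%:R :> R by rewrite ltr0n.
move=> h1 h2; split; first by rewrite divr_ge0 ?exprn_ge0//= ler_pdivrMr ?exprn_gt0// mul1r.
rewrite ler_pdivlMr ?exprn_gt0//.
have -> : (1 - d%:R / N%:R) * N%:R ^+ 2 = N%:R ^+ 2 - d%:R * N%:R :> R.
  by field; rewrite gt_eqF.
lra.
Qed.

Lemma coprime_density_limit (e : R) : 0 < e ->
  exists X, forall N, (0 < N)%N -> (X <= N)%N ->
    `|coprime_density N 1 - 6 / pi ^+ 2| <= e.
Proof.
move=> e0; have [|||X HX] := @contraction_limit R coprime_density _ _ _ e e0.
- move=> N d; rewrite /coprime_density divr_ge0 ?exprn_ge0// mulr_ge0//.
  by rewrite mulr_ge0 ?exprn_ge0.
- move=> N d N0 d0; rewrite coprime_density_sum//.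
  by have [/andP[u0 u1] _] := line_ratio_bounds N0 d0; rewrite exprn_ile1.
- move=> N d N0 d0; rewrite coprime_density_sum//.
  have [/andP[]] := line_ratio_bounds N0 d0.
  move: (_ / N%:R ^+ 2) (d%:R / N%:R) => u v *; nra.
exists X => N N0 XN; rewrite -[6 / _]invf_div; apply: HX => //.
by rewrite muln1.
Qed.

Lemma card_edges N : (1 < N)%N ->
  #|edges N N.-1| = (4 * coprime_sum N 1 + 4 * (N * N.-1))%N.
Proof.
move=> N1; rewrite -sum_coprime_differences// -sum1_card big_mkcond/=.
pose C (x1 x2 y1 y2 : 'I_N) : nat :=
  coprime `|y1%:Z - x1%:Z| `|y2%:Z - x2%:Z|.
transitivity (\sum_(x : lattice N) \sum_(y : lattice N) C x.1 x.2 y.1 y.2)%N.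
  by rewrite pair_bigA; apply: eq_bigr => -[x y] _; rewrite mem_edges// /C; case: coprime.
transitivity (\sum_x1 \sum_x2 \sum_y1 \sum_y2 C x1 x2 y1 y2)%N.
  rewrite [RHS]pair_bigA; apply: eq_bigr => -[x1 x2] _.
  by rewrite [RHS]pair_bigA; apply: eq_bigr => -[].
by apply: eq_bigr => x1 _; rewrite exchange_big.
Qed.

Lemma cvg_card_edges :
  #|edges N N.-1|%:R / (N%:R : R) ^+ 4 @[N --> \oo] --> 6 / (pi : R) ^+ 2.
Proof.
apply/cvgrPdist_le => e e0; have e2 : 0 < e / 2 by rewrite divr_gt0.
have [X HX] := coprime_density_limit e2.
have [Y hY] : exists Y : nat, 4 / (e / 2) <= Y%:R.
  by exists (Num.trunc (4 / (e / 2))).+1; rewrite ltW// truncnS_gt.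
exists (maxn 2 (maxn X Y)) => // N /=; rewrite !geq_max => /and3P[N1 XN YN].
have N0 : (0 < N)%N by exact: ltnW.
have NR : 0 < N%:R :> R by rewrite ltr0n.
pose q : R := 4 * (N * N.-1)%N%:R / N%:R ^+ 4.
have -> : #|edges N N.-1|%:R / N%:R ^+ 4 = coprime_density N 1 + q.
  rewrite card_edges// /coprime_density /q natrD !(natrM _ 4) expr1n mulr1.
  by rewrite mulrDl.
have q0 : 0 <= q by rewrite divr_ge0 ?exprn_ge0// mulr_ge0.
have qe : q <= e / 2.
  apply: (@le_trans _ _ (4 / N%:R)).
    rewrite ler_pdivrMr ?exprn_gt0//.
    have -> : 4 / N%:R * N%:R ^+ 4 = 4 * (N * N ^ 2)%N%:R :> R.
      by rewrite natrM natrX; field; rewrite gt_eqF.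
    rewrite ler_wpM2l// ler_nat leq_mul2l; apply/orP; right; nia.
  rewrite ler_pdivrMr// mulrC -ler_pdivrMr// (le_trans hY)// ler_nat//.
rewrite distrC -addrAC (le_trans (ler_normD _ _))// (ger0_norm q0).
by rewrite [e]splitr lerD// HX.
Qed.

End Density.

Theorem proposition3p3 (R : realType) :
  (forall N : nat, (2 <= N)%N ->
    [/\ forall x y : lattice N,
          graph_dist (edges N N.-1) (@d2 R N) x y = d2 R x y,
        Gamma (edges N N.-1) (@d2 R N) = 0 &
        forall mu nu : lattice N -> R,
          prob_vector mu -> prob_vector nu ->
          wasserstein (@d2 R N) mu nu
          = flow_cost (edges N N.-1) (@d2 R N) (fun x => mu x - nu x)]) /\
  (#|edges N N.-1|%:R / (N%:R : R) ^+ 4 @[N --> \oo] --> 6 / (pi : R) ^+ 2).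
Proof.
split=> [N N1|]; last exact: cvg_card_edges.
split=> [x y||mu nu mu_prob nu_prob]; first exact: graph_dist_d2.
  exact: Gamma_d2.
apply: wasserstein_flow_cost => //; first exact: d2xx.
  exact: d2_triangle.
exact: geodesic.
Qed.
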